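(* Let $\mathcal{C}$ be a full subcategory of the category of non-empty path-connected spaces and continuous maps, and let $X$ be a path-connected space. If $\mathcal{C}$ has the closed unit disk $D^2$ as an object, then the canonical functor $\mathbf{Cov}_{\mathcal{C}}(X)\to\Delta\mathbf{Cov}(X)$ is fully faithful; in particular there is a canonical fully faithful functor $\mathbf{Cov}_{\mathcal{C}}(X)\to\Delta\mathbf{Cov}(X)$.
   Context: Maps are continuous functions. A subset $U\subseteq X$ is $\Delta$-open if $f^{-1}(U)$ is open in $D^2$ for every map $f:D^2\to X$. A space is $\Delta$-generated if its open sets are exactly its $\Delta$-open sets. $\Delta\mathbf{Top}_0$ is the category of path-connected $\Delta$-generated spaces. For a path-connected space $E$, $\Delta(E)$ is the space with the same underlying set as $E$ whose open sets are the $\Delta$-open subsets of $E$. For a full subcategory $\mathcal{A}$ of the category of non-empty path-connected spaces with $D^2\in\mathcal{A}$, an $\mathcal{A}$-covering map is a map $p:\widetilde{X}\to X$ such that (1) $\widetilde{X}\in\mathcal{A}$, and (2) for every $Y\in\mathcal{A}$, $\tilde{x}\in\widetilde{X}$, $y\in Y$ and based map $f:(Y,y)\to(X,p(\tilde{x}))$ with $f_*(\pi_1(Y,y))\subseteq p_*(\pi_1(\widetilde{X},\tilde{x}))$, there is a unique map $\tilde{f}:(Y,y)\to(\widetilde{X},\tilde{x})$ with $p\circ\tilde{f}=f$. $\mathbf{Cov}_{\mathcal{A}}(X)$ is the category of $\mathcal{A}$-coverings over $X$, where a morphism from $p:E\to X$ to $q:E'\to X$ is a map $f:E\to E'$ with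 $q\circ f=p$. A $\Delta$-covering is a $\Delta\mathbf{Top}_0$-covering, and $\Delta\mathbf{Cov}(X)=\mathbf{Cov}_{\Delta\mathbf{Top}_0}(X)$. The canonical functor $\mathbf{Cov}_{\mathcal{C}}(X)\to\Delta\mathbf{Cov}(X)$ sends a $\mathcal{C}$-covering $p:\widetilde{X}\to X$ to the map $p:\Delta(\widetilde{X})\to X$ and is the identity on underlying functions of morphisms. *)

(* Defs.v *)
From HB Require Import structures.
From mathcomp Require Import all_boot all_order all_algebra.
From mathcomp Require Import all_classical all_reals all_analysis homotopy.

Import Order.TTheory GRing.Theory Num.Theory.
Import numFieldNormedType.Exports.

Set Implicit Arguments.
Unset Strict Implicit.
Unset Printing Implicit Defensive.

Local Open Scope classical_set_scope.
Local Open Scope ring_scope.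

Record category := Category {
  cat_ob : Type;
  cat_hom : cat_ob -> cat_ob -> Type;
  cat_id : forall a, cat_hom a a;
  cat_comp : forall a b c, cat_hom b c -> cat_hom a b -> cat_hom a c;
  cat_comp_idl : forall a b (f : cat_hom a b), cat_comp (cat_id b) f = f;
  cat_comp_idr : forall a b (f : cat_hom a b), cat_comp f (cat_id a) = f;
  cat_compA : forall a b c d (h : cat_hom c d) (g : cat_hom b c) (f : cat_hom a b),
    cat_comp h (cat_comp g f) = cat_comp (cat_comp h g) f
}.

Record functor (C D : category) := Functor {
  fob : cat_ob C -> cat_ob D;
  fhom : forall a b : cat_ob C, cat_hom a b -> cat_hom (fob a) (fob b);
  fhom_id : forall a : cat_ob C, fhom (cat_id a) = cat_id (fob a);
  fhom_comp : forall (a b c : cat_ob C) (g : cat_hom b c) (f : cat_hom a b),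
    fhom (cat_comp g f) = cat_comp (fhom g) (fhom f)
}.

Definition faithful (C D : category) (F : functor C D) : Prop :=
  forall (a b : cat_ob C) (f g : cat_hom a b), fhom F f = fhom F g -> f = g.

Definition full (C D : category) (F : functor C D) : Prop :=
  forall (a b : cat_ob C) (g : cat_hom (fob F a) (fob F b)),
    exists f : cat_hom a b, fhom F f = g.

Definition fully_faithful (C D : category) (F : functor C D) : Prop :=
  full F /\ faithful F.

(* The closed unit disk D^2 and the unit interval, with the subspace topology,
   which is the topology that the library puts on [set_type]. *)
Definition disk (R : realType) : Type :=
  set_type [set z : R * R | z.1 ^+ 2 + z.2 ^+ 2 <= 1].
HB.instance Definition _ (R : realType) :=
  Topological.copy (disk R)
    (set_type [set z : R * R | z.1 ^+ 2 + z.2 ^+ 2 <= 1]).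

Definition itv01 (R : realType) : Type := set_type [set t : R | 0 <= t <= 1].
HB.instance Definition _ (R : realType) :=
  Topological.copy (itv01 R) (set_type [set t : R | 0 <= t <= 1]).

Section itv01_bipointed.
Variable R : realType.

Let mem0 : 0 \in [set t : R | 0 <= t <= 1].
Proof. by apply/mem_set => /=; rewrite lexx ler01. Qed.

Let mem1 : 1 \in [set t : R | 0 <= t <= 1].
Proof. by apply/mem_set => /=; rewrite lexx ler01. Qed.

Let neq01 : exist _ 0 mem0 != exist _ 1 mem1 :> itv01 R.
Proof. by apply/eqP => -[] /eqP; rewrite eq_sym oner_eq0. Qed.

HB.instance Definition _ := @isBiPointed.Build (itv01 R) _ _ neq01.
End itv01_bipointed.

Definition path_connected (R : realType) (X : topologicalType) : Prop :=
  forall x y : X, inhabited {path itv01 R from x to y in X}.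

Definition nonempty_path_connected (R : realType) (X : topologicalType) : Prop :=
  [set: X] !=set0 /\ path_connected R X.

Definition path_homotopic (R : realType) (X : topologicalType)
    (g h : itv01 R -> X) : Prop :=
  exists H : itv01 R * itv01 R -> X,
    [/\ continuous H,
        forall s, H (s, zero) = g s /\ H (s, one) = h s &
        forall t, H (zero, t) = g zero /\ H (one, t) = g one].

Definition loop (R : realType) (X : topologicalType) (x : X) : Type :=
  {path itv01 R from x to x in X}.

(* The underlying set of the fundamental group: path-homotopy classes of loops,
   each represented by the set of its members.  The group law is omitted: only
   inclusions between images of fundamental groups are needed. *)
Definition pi1 (R : realType) (X : topologicalType) (x : X) :
    set (set (loop R x)) :=
  [set [set h : loop R x | path_homotopic g h] | g in [set: loop R x]].
Arguments pi1 R {X} x.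

(* The map induced on classes by a based map f : (Y, y) -> (X, x).  The equation
   f y = x is not required by the type; it is a hypothesis wherever this is
   used, so that no transport between pi1 (f y) and pi1 x is needed. *)
Definition pi1_map (R : realType) (Y X : topologicalType) (f : Y -> X)
    (y : Y) (x : X) (c : set (loop R y)) : set (loop R x) :=
  [set h : loop R x | exists2 g : loop R y, c g & path_homotopic (f \o g) h].
Arguments pi1_map {R Y X} f y x c.

Definition Delta_open (R : realType) (X : topologicalType) (U : set X) : Prop :=
  forall f : disk R -> X, continuous f -> open (f @^-1` U).

Definition Delta_generated (R : realType) (X : topologicalType) : Prop :=
  forall U : set X, open U <-> Delta_open R U.

Definition DeltaTop0 (R : realType) (X : topologicalType) : Prop :=
  nonempty_path_connected R X /\ Delta_generated R X.

Definition Delta (R : realType) (E : topologicalType) : Type := E.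

Section Delta_topology.
Variables (R : realType) (E : topologicalType).

Let DeltaT : Delta_open R [set: E].
Proof. by move=> f _; rewrite preimage_setT; exact: openT. Qed.

Let DeltaI : setI_closed (@Delta_open R E).
Proof.
by move=> U V oU oV f cf; rewrite preimage_setI; apply: openI; [exact: oU|exact: oV].
Qed.

Let Delta_bigU (I : Type) (F : I -> set E) :
  (forall i, Delta_open R (F i)) -> Delta_open R (\bigcup_i F i).
Proof.
move=> oF f cf; rewrite preimage_bigcup; apply: bigcup_open => i _.
exact: oF.
Qed.

HB.instance Definition _ := Choice.copy (Delta R E) E.
HB.instance Definition _ :=
  isOpenTopological.Build (Delta R E) DeltaT DeltaI Delta_bigU.

Lemma open_DeltaE (U : set E) :
  open (U : set (Delta R E)) <-> Delta_open R U.
Proof. by []. Qed.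

End Delta_topology.

Lemma Delta_continuous (R : realType) (E E' : topologicalType) (f : E -> E') :
  continuous f -> continuous (f : Delta R E -> Delta R E').
Proof.
move=> cf; apply/continuousP => U /open_DeltaE oU; apply/open_DeltaE => u cu.
by apply: (oU (f \o u)) => z; apply: continuous_comp; [exact: cu|exact: cf].
Qed.

(* [A] is the class of objects of a full subcategory of spaces. *)
Definition is_covering (R : realType) (A : topologicalType -> Prop)
    (E X : topologicalType) (p : E -> X) : Prop :=
  [/\ continuous p, A E &
    forall (Y : topologicalType) (e : E) (y : Y) (f : Y -> X),
      A Y -> continuous f -> f y = p e ->
      pi1_map f y (p e) @` pi1 R y `<=` pi1_map p e (p e) @` pi1 R e ->
      exists! g : Y -> E, [/\ continuous g, g y = e & p \o g = f]].

Record covering (R : realType) (A : topologicalType -> Prop)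
    (X : topologicalType) := Covering {
  cov_space : topologicalType;
  cov_map : cov_space -> X;
  cov_mapP : is_covering R A cov_map
}.
Arguments cov_map {R A X} _ _.

Record cov_hom (R : realType) (A : topologicalType -> Prop)
    (X : topologicalType) (p q : covering R A X) := CovHom {
  cov_fun :> cov_space p -> cov_space q;
  cov_fun_continuous : continuous cov_fun;
  cov_funE : cov_map q \o cov_fun = cov_map p
}.
Arguments cov_fun_continuous {R A X p q} _.

Section Cov_category.
Variables (R : realType) (A : topologicalType -> Prop) (X : topologicalType).
Implicit Types p q r s : covering R A X.

Lemma cov_hom_eq p q (f g : cov_hom p q) : cov_fun f = cov_fun g -> f = g.
Proof.
case: f g => [f cf Ef] [g cg Eg] /= fg; subst g.
by rewrite (Prop_irrelevance cf cg) (Prop_irrelevance Ef Eg).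
Qed.

Lemma cov_id_continuous p : continuous (@idfun (cov_space p)).
Proof. by move=> x. Qed.

Definition cov_id p : cov_hom p p :=
  @CovHom R A X p p idfun (@cov_id_continuous p) erefl.

Lemma cov_comp_continuous p q r (g : cov_hom q r) (f : cov_hom p q) :
  continuous (g \o f).
Proof.
by move=> x; apply: continuous_comp; exact: cov_fun_continuous.
Qed.

Lemma cov_compE p q r (g : cov_hom q r) (f : cov_hom p q) :
  cov_map r \o (g \o f) = cov_map p.
Proof. by rewrite -(cov_funE f) -(cov_funE g). Qed.

Definition cov_comp p q r (g : cov_hom q r) (f : cov_hom p q) : cov_hom p r :=
  @CovHom R A X p r (g \o f) (@cov_comp_continuous p q r g f) (cov_compE g f).

Definition Cov : category.
Proof.
refine (@Category (covering R A X) (@cov_hom R A X) cov_id cov_comp _ _ _);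
  by move=> *; exact: cov_hom_eq.
Defined.

End Cov_category.

Definition DeltaCov (R : realType) (X : topologicalType) : category :=
  Cov R (DeltaTop0 R) X.

Definition Delta_map (R : realType) (C : topologicalType -> Prop)
    (X : topologicalType) (p : covering R C X) : Delta R (cov_space p) -> X :=
  cov_map p.
Arguments Delta_map {R C X} p _.

(* The functor p |-> Delta_map p, identity on underlying functions.  That
   Delta_map p is a covering for Delta-generated spaces is a theorem, not a
   matter of definition; its proof is the argument [wd] and is only used to
   form the target objects. *)
Section canonical_functor.
Variables (R : realType) (C : topologicalType -> Prop) (X : topologicalType).
Variable wd :
  forall p : covering R C X, is_covering R (DeltaTop0 R) (Delta_map p).

Definition canonical_ob (p : covering R C X) : covering R (DeltaTop0 R) X :=
  Covering (wd p).

Definition canonical_hom (p q : covering R C X) (f : cov_hom p q) :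
    cov_hom (canonical_ob p) (canonical_ob q) :=
  @CovHom R (DeltaTop0 R) X (canonical_ob p) (canonical_ob q)
    f (Delta_continuous (cov_fun_continuous f)) (cov_funE f).

Definition canonical_functor : functor (Cov R C X) (DeltaCov R X).
Proof.
refine (@Functor (Cov R C X) (DeltaCov R X) canonical_ob canonical_hom _ _);
  by move=> *; exact: cov_hom_eq.
Defined.

End canonical_functor.

(* Main.v *)
Require Import Defs.
From HB Require Import structures.
From mathcomp Require Import all_boot all_order all_algebra.
From mathcomp Require Import all_classical all_reals all_analysis homotopy.
From mathcomp Require Import lra.

(* The interval and the square are retracts of the disk, so a covering for a
   class containing the disk has unique lifts of paths and of homotopies, and
   E and Delta E have the same disks, paths and homotopies.  A map f : Y -> X
   satisfying the pi_1 condition is lifted by sending the end of a path g in Y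
   to the end of the lift of f \o g;
   this is well defined by homotopy lifting, and continuous for a
   Delta-generated Y because it restricts to a lift of f \o u on every disk
   u in Y.  For fullness, a continuous h : Delta E -> Delta E' over X shows that
   p : E -> X satisfies the pi_1 condition for q : E' -> X; the resulting
   continuous lift agrees with h along paths. *)

Import Order.TTheory GRing.Theory Num.Theory.
Import numFieldNormedType.Exports.

Set Implicit Arguments.
Unset Strict Implicit.
Unset Printing Implicit Defensive.

Local Open Scope classical_set_scope.
Local Open Scope ring_scope.

(** * Continuity of composed, paired and pasted maps *)

Lemma continuous_compT (S T U : topologicalType) (f : S -> T) (g : T -> U) :
  continuous f -> continuous g -> continuous (g \o f).
Proof. by move=> cf cg x; apply: continuous_comp; [exact: cf|exact: cg]. Qed.

Lemma continuous_pair (S T U : topologicalType) (f : S -> T) (g : S -> U) :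
  continuous f -> continuous g -> continuous (fun x => (f x, g x)).
Proof. by move=> cf cg x; apply: cvg_pair; [exact: cf|exact: cg]. Qed.

Lemma continuous_fst (S T : topologicalType) : continuous (@fst S T).
Proof. by move=> x; apply: cvg_fst. Qed.

Lemma continuous_snd (S T : topologicalType) : continuous (@snd S T).
Proof. by move=> x; apply: cvg_snd. Qed.

Lemma continuous_realD (R : realType) (T : topologicalType) (f g : T -> R) :
  continuous f -> continuous g -> continuous (fun x => f x + g x).
Proof. by move=> cf cg x; apply: cvgD; [exact: cf|exact: cg]. Qed.

Lemma continuous_realM (R : realType) (T : topologicalType) (f g : T -> R) :
  continuous f -> continuous g -> continuous (fun x => f x * g x).
Proof. by move=> cf cg x; apply: cvgM; [exact: cf|exact: cg]. Qed.

(** Away from the zeros of [u] a single branch applies near [x]; at a zero the branches agree, so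
    [f] and [g] both map a neighborhood of [x] into [W]. *)
Lemma continuous_paste (R : realType) (T Z : topologicalType) (u : T -> R)
    (f g : T -> Z) :
  continuous u -> continuous f -> continuous g ->
  (forall x, u x = 0 -> f x = g x) ->
  continuous (fun x => if u x <= 0 then f x else g x).
Proof.
move=> cu cf cg fg x W /= nW.
change (\forall y \near x, W (if u y <= 0 then f y else g y)).
have [ux|ux|ux] := ltgtP (u x) 0; move: nW.
- have /cu uN : \forall r \near u x, r < 0 by exact: lt_nbhsl.
  rewrite (ltW ux) => /cf fN; near=> y.
  rewrite ifT; first by near: y.
  by apply/ltW; near: y.
- have /cu uN : \forall r \near u x, 0 < r.
    by apply: open_nbhs_nbhs; split; [exact: open_gt|].
  rewrite leNgt ux => /cg gN; near=> y.
  rewrite ifF; first by near: y.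
  by apply/negbTE; rewrite -ltNge; near: y.
- rewrite ux lexx => nW; have gW : nbhs (g x) W by rewrite -fg.
  move/cf: nW => fN; move/cg: gW => gN; near=> y.
  by case: ifP => _; near: y.
Unshelve. all: end_near. Qed.

(** * The unit interval and concatenation of paths *)

Section unit_interval.
Variable R : realType.
Local Notation I := (itv01 R).

Definition ival (t : I) : R := set_val t.

Lemma ival_continuous : continuous ival.
Proof. exact: initial_continuous. Qed.

Lemma ival_inj : injective ival.
Proof. exact: val_inj. Qed.

Lemma ival_bounds (t : I) : 0 <= ival t <= 1.
Proof. exact: (set_mem (valP t)). Qed.

Lemma ival_zero : ival zero = 0. Proof. by []. Qed.

Lemma ival_one : ival one = 1. Proof. by []. Qed.

Lemma clamp_subproof (a : R) :
  Num.max 0 (Num.min 1 a) \in [set t : R | 0 <= t <= 1].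
Proof.
by apply/mem_set; rewrite /= le_max lexx /= ge_max ler01 ge_min lexx.
Qed.

(** The retraction of the line onto the interval. Maps into the interval are clamped real formulas,
    so bounds are needed only to compute values. *)
Definition clamp (a : R) : I :=
  exist (fun t => t \in [set t : R | 0 <= t <= 1]) _ (clamp_subproof a).

Lemma clampK (a : R) : 0 <= a <= 1 -> ival (clamp a) = a.
Proof.
move=> /andP[a0 a1]; change (Num.max 0 (Num.min 1 a) = a).
by rewrite (min_idPr a1) (max_idPr a0).
Qed.

Lemma ivalK : cancel ival clamp.
Proof. by move=> t; apply: ival_inj; rewrite clampK ?ival_bounds. Qed.

Lemma clamp_continuous : continuous clamp.
Proof.
apply: continuous_comp_initial => a.
apply: (@continuous_max R R (cst 0) (fun b => Num.min 1 b)); first exact: cvg_cst.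
by apply: (@continuous_min R R (cst 1) id); [exact: cvg_cst|exact: cvg_id].
Qed.

Lemma clamp_comp_continuous (T : topologicalType) (f : T -> R) :
  continuous f -> continuous (fun x => clamp (f x)).
Proof. by move=> cf; exact: continuous_compT cf clamp_continuous. Qed.

Lemma ival_comp_continuous (T : topologicalType) (f : T -> I) :
  continuous f -> continuous (fun x => ival (f x)).
Proof. by move=> cf; exact: continuous_compT cf ival_continuous. Qed.

Definition aff (a b : R) (t : I) : I := clamp (a * ival t + b).

Lemma aff_continuous (a b : R) : continuous (aff a b).
Proof.
apply: clamp_comp_continuous; apply: continuous_realD; last exact: cst_continuous.
apply: continuous_realM; first exact: cst_continuous.
exact: ival_continuous.
Qed.

Definition itv_rev : I -> I := aff (-1) 1.
(** [dbl1] and [dbl2] stretch the two halves of the interval onto the whole; [half1] and [half2]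
    embed the interval as these halves. *)
Definition dbl1 : I -> I := aff 2 0.
Definition dbl2 : I -> I := aff 2 (-1).
Definition half1 : I -> I := aff 2^-1 0.
Definition half2 : I -> I := aff 2^-1 2^-1.

Lemma affK (a b : R) (t : I) :
  0 <= a * ival t + b <= 1 -> ival (aff a b t) = a * ival t + b.
Proof. exact: clampK. Qed.

Lemma itv_rev0 : itv_rev zero = one.
Proof. by apply: ival_inj; rewrite affK ival_zero ?ival_one; lra. Qed.

Lemma itv_rev1 : itv_rev one = zero.
Proof. by apply: ival_inj; rewrite affK ival_one ?ival_zero; lra. Qed.

Lemma itv_revK : involutive itv_rev.
Proof.
move=> t; apply: ival_inj; have /andP[t0 t1] := ival_bounds t.
by rewrite affK affK; lra.
Qed.

Lemma half1_0 : half1 zero = zero.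
Proof. by apply: ival_inj; rewrite affK ival_zero; lra. Qed.

Lemma half2_1 : half2 one = one.
Proof. by apply: ival_inj; rewrite affK ival_one; lra. Qed.

Lemma half_mid : half1 one = half2 zero.
Proof. by apply: ival_inj; rewrite !affK ?ival_zero ?ival_one; lra. Qed.

(** Concatenation of paths; the test has the shape [u t <= 0] so that [continuous_paste] applies. *)
Definition chain (Z : Type) (a b : I -> Z) (t : I) : Z :=
  if ival t - 1 / 2 <= 0 then a (dbl1 t) else b (dbl2 t).

Lemma chain_continuous (Z : topologicalType) (a b : I -> Z) :
  continuous a -> continuous b -> a one = b zero -> continuous (chain a b).
Proof.
move=> ca cb ab; apply: (@continuous_paste R) => [|||t tE].
- apply: continuous_realD; [exact: ival_continuous|exact: cst_continuous].
- exact: continuous_compT (@aff_continuous _ _) ca.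
- exact: continuous_compT (@aff_continuous _ _) cb.
- have -> : dbl1 t = one by apply: ival_inj; rewrite affK ?ival_one; lra.
  by rewrite ab; congr b; apply: ival_inj; rewrite affK ?ival_zero; lra.
Qed.

Lemma chain_half1 (Z : Type) (a b : I -> Z) : chain a b \o half1 = a.
Proof.
apply/funext => t; have /andP[t0 t1] := ival_bounds t.
have h1E : ival (half1 t) = 2^-1 * ival t + 0 by apply: affK; lra.
rewrite /chain /= ifT ?h1E; last lra.
by congr a; apply: ival_inj; rewrite affK h1E; lra.
Qed.

Lemma chain_half2 (Z : Type) (a b : I -> Z) :
  a one = b zero -> chain a b \o half2 = b.
Proof.
move=> ab; apply/funext => t; have /andP[t0 t1] := ival_bounds t.
have h2E : ival (half2 t) = 2^-1 * ival t + 2^-1 by apply: affK; lra.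
rewrite /chain /= h2E; case: ifPn => [tle|_].
  (* The midpoint falls under the first branch, where the value is [a one], that is, [b zero]. *)
  have tE : t = zero by apply: ival_inj; rewrite ival_zero; lra.
  rewrite tE -ab -tE; congr a; apply: ival_inj.
  by rewrite affK h2E tE ival_zero ?ival_one; lra.
by congr b; apply: ival_inj; rewrite affK h2E; lra.
Qed.

Lemma chain0 (Z : Type) (a b : I -> Z) : chain a b zero = a zero.
Proof. by rewrite -[in LHS]half1_0 -[in RHS](chain_half1 a b). Qed.

Lemma chain1 (Z : Type) (a b : I -> Z) :
  a one = b zero -> chain a b one = b one.
Proof. by move=> ab; rewrite -[in LHS]half2_1 -[in RHS](chain_half2 ab). Qed.

Lemma comp_chain (Y Z : Type) (f : Y -> Z) (a b : I -> Y) :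
  f \o chain a b = chain (f \o a) (f \o b).
Proof. by apply/funext => t; rewrite /chain /=; case: ifP. Qed.

End unit_interval.

(** * Segments in the disk and retracts of the disk *)

Section disk_retracts.
Variable R : realType.
Local Notation I := (itv01 R).
Local Notation D := (disk R).
Local Notation inD := (fun z => z \in [set z : R * R | z.1 ^+ 2 + z.2 ^+ 2 <= 1]).

Definition dval (z : D) : R * R := set_val z.

Lemma dval_continuous : continuous dval.
Proof. exact: initial_continuous. Qed.

Lemma dval_inj : injective dval.
Proof. exact: val_inj. Qed.

Lemma dvalP (z : D) : (dval z).1 ^+ 2 + (dval z).2 ^+ 2 <= 1.
Proof. exact: (set_mem (valP z)). Qed.

Lemma continuous_into_disk (T : topologicalType) (f : T -> D) :
  continuous (fun x => (dval (f x)).1) -> continuous (fun x => (dval (f x)).2) ->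
  continuous f.
Proof.
move=> c1 c2; apply: continuous_comp_initial.
have -> : set_val \o f = (fun x => ((dval (f x)).1, (dval (f x)).2)).
  by apply/funext => x /=; rewrite -surjective_pairing.
exact: continuous_pair.
Qed.

Lemma dval1_continuous : continuous (fun z : D => (dval z).1).
Proof. exact: continuous_compT dval_continuous (@continuous_fst _ _). Qed.

Lemma dval2_continuous : continuous (fun z : D => (dval z).2).
Proof. exact: continuous_compT dval_continuous (@continuous_snd _ _). Qed.

Lemma segment_subproof (z w : D) (t : I) :
  inD ((dval z).1 + ival t * ((dval w).1 - (dval z).1),
       (dval z).2 + ival t * ((dval w).2 - (dval z).2)).
Proof.
apply/mem_set => /=; have /andP[t0 t1] := ival_bounds t.
have := dvalP z; have := dvalP w.
move: (dval z) (dval w) (ival t) t0 t1 => [a b] [c d] {}t /= t0 t1 zP wP.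
(* Convexity: |(1-t)z + tw|^2 = (1-t)|z|^2 + t|w|^2 - t(1-t)|z-w|^2. *)
have : 0 <= t * (1 - t) * ((a - c) ^+ 2 + (b - d) ^+ 2).
  by rewrite mulr_ge0 ?addr_ge0 ?sqr_ge0 // mulr_ge0 ?subr_ge0.
have : t * (c ^+ 2 + d ^+ 2) <= t * 1 by rewrite ler_wpM2l.
have : (1 - t) * (a ^+ 2 + b ^+ 2) <= (1 - t) * 1.
  by rewrite ler_wpM2l ?subr_ge0.
lra.
Qed.

Definition segment (z w : D) (t : I) : D := exist inD _ (segment_subproof z w t).

Lemma dval_segment (z w : D) (t : I) : dval (segment z w t) =
  ((dval z).1 + ival t * ((dval w).1 - (dval z).1),
   (dval z).2 + ival t * ((dval w).2 - (dval z).2)).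
Proof. by []. Qed.

Lemma segment0 (z w : D) : segment z w zero = z.
Proof.
by apply: dval_inj; rewrite dval_segment ival_zero !mul0r !addr0 -surjective_pairing.
Qed.

Lemma segment1 (z w : D) : segment z w one = w.
Proof.
by apply: dval_inj; rewrite dval_segment ival_one !mul1r !subrKC -surjective_pairing.
Qed.

Lemma segmentxx (z : D) (t : I) : segment z z t = z.
Proof.
by apply: dval_inj; rewrite dval_segment !subrr !mulr0 !addr0 -surjective_pairing.
Qed.

Lemma segment_continuous (T : topologicalType) (f g : T -> D) (h : T -> I) :
  continuous f -> continuous g -> continuous h ->
  continuous (fun x => segment (f x) (g x) (h x)).
Proof.
move=> cf cg ch.
have cseg (u v : T -> R) : continuous u -> continuous v ->
    continuous (fun x => u x + ival (h x) * (v x - u x)).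
  move=> cu cv; apply: continuous_realD => //; apply: continuous_realM.
    exact: ival_comp_continuous.
  by apply: continuous_realD => // x; apply: cvgN; exact: cu.
apply: continuous_into_disk; apply: cseg.
- exact: continuous_compT cf (@dval1_continuous).
- exact: continuous_compT cg (@dval1_continuous).
- exact: continuous_compT cf (@dval2_continuous).
- exact: continuous_compT cg (@dval2_continuous).
Qed.

(** A lifting problem on such a [Z] moves to the disk along [r], and its solution comes back along
    [s]. *)
Definition disk_retract (Z : topologicalType) : Prop :=
  exists (s : Z -> D) (r : D -> Z), [/\ continuous s, continuous r & cancel s r].

Lemma disk_retract_disk : disk_retract D.
Proof. by exists id, id; split=> // x; exact: cvg_id. Qed.

(** Halving puts the unit square inside the disk, since (a^2 + b^2)/4 is at most 1/2. *)
Lemma square_disk_subproof (x : I * I) : inD (2^-1 * ival x.1, 2^-1 * ival x.2).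
Proof.
apply/mem_set => /=; have := ival_bounds x.1; have := ival_bounds x.2.
by move: (ival x.1) (ival x.2) => a b /andP[b0 b1] /andP[a0 a1]; nra.
Qed.

Definition square_disk (x : I * I) : D := exist inD _ (square_disk_subproof x).

Lemma disk_retract_square : disk_retract (I * I)%type.
Proof.
(* Doubling undoes the scaling; clamping keeps the result in the square on the rest of the disk. *)
exists square_disk, (fun z => (clamp (2 * (dval z).1), clamp (2 * (dval z).2))).
have cc (T : topologicalType) (a : R) (f : T -> R) :
    continuous f -> continuous (fun x => a * f x).
  by move=> cf; apply: continuous_realM; first exact: cst_continuous.
split=> [||[a b]].
- apply: continuous_into_disk; apply: cc; apply: ival_comp_continuous.
  + exact: continuous_fst.
  + exact: continuous_snd.
- apply: continuous_pair; apply: clamp_comp_continuous; apply: cc.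
  + exact: dval1_continuous.
  + exact: dval2_continuous.
- by rewrite /dval /= !mulVKf // !ivalK.
Qed.

Lemma disk_retract_itv01 : disk_retract I.
Proof.
have [s [r [cs cr srK]]] := disk_retract_square.
(* The interval is an edge of the square. *)
exists (fun t => s (t, zero)), (fun z => (r z).1); split=> [||t].
- apply: (continuous_compT _ cs); apply: continuous_pair; last exact: cst_continuous.
  by move=> x; exact: cvg_id.
- exact: continuous_compT cr (@continuous_fst _ _).
- by rewrite srK.
Qed.

End disk_retracts.

(** * Path homotopy and the condition on fundamental groups *)

Section homotopy.
Variable R : realType.
Local Notation I := (itv01 R).

Lemma path_homotopic_refl (X : topologicalType) (g : I -> X) :
  continuous g -> path_homotopic g g.
Proof.
move=> cg; exists (g \o fst); split=> //.
exact: continuous_compT (@continuous_fst _ _) cg.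
Qed.

Lemma path_homotopic_sym (X : topologicalType) (g h : I -> X) :
  path_homotopic g h -> path_homotopic h g.
Proof.
move=> [H [cH Hs Ht]]; exists (fun x => H (x.1, itv_rev x.2)); split.
- apply: (continuous_compT _ cH); apply: continuous_pair.
    exact: continuous_fst.
  exact: continuous_compT (@continuous_snd _ _) (@aff_continuous _ _ _).
- by move=> s /=; rewrite itv_rev0 itv_rev1; have [] := Hs s.
- move=> t /=; have [-> ->] := Ht (itv_rev t).
  (* The ends of [h] are corners of [H], hence the ends of [g]. *)
  have [_ <-] := Hs zero; have [_ <-] := Hs one.
  by have [-> ->] := Ht one.
Qed.

Lemma path_homotopic_trans (X : topologicalType) (g h k : I -> X) :
  path_homotopic g h -> path_homotopic h k -> path_homotopic g k.
Proof.
move=> [H [cH Hs Ht]] [K [cK Ks Kt]].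
exists (fun x => chain (fun t => H (x.1, t)) (fun t => K (x.1, t)) x.2).
have HK s : H (s, one) = K (s, zero) by rewrite (Hs s).2 (Ks s).1.
split=> [|s|t].
- apply: (@continuous_paste R) => [|||[s t] /= tE].
  + apply: continuous_realD; last exact: cst_continuous.
    exact: ival_comp_continuous (@continuous_snd _ _).
  + apply: (continuous_compT _ cH); apply: continuous_pair.
      exact: continuous_fst.
    exact: continuous_compT (@continuous_snd _ _) (@aff_continuous _ _ _).
  + apply: (continuous_compT _ cK); apply: continuous_pair.
      exact: continuous_fst.
    exact: continuous_compT (@continuous_snd _ _) (@aff_continuous _ _ _).
  + have -> : dbl1 t = one by apply: ival_inj; rewrite affK ?ival_one; lra.
    by rewrite HK; congr (K (s, _)); apply: ival_inj; rewrite affK ?ival_zero; lra.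
- by rewrite /= chain0 chain1 // (Hs s).1 (Ks s).2.
- have [h0 h1] : h zero = g zero /\ h one = g one.
    by rewrite -(Hs zero).2 -(Hs one).2; exact: Ht.
  by rewrite /chain /=; case: ifP => _; [exact: Ht|rewrite -h0 -h1; exact: Kt].
Qed.

(** Straight-line homotopy to the base point. It makes every continuous based map on the disk
    satisfy the pi_1 condition. *)
Lemma disk_loop_null (z : disk R) (g : loop R z) : path_homotopic g (cst z).
Proof.
exists (fun x => segment (g x.1) z x.2); split=> [|s|t].
- apply: segment_continuous; last exact: continuous_snd.
    exact: continuous_compT (@continuous_fst _ _) (@cts_fun _ _ g).
  exact: cst_continuous.
- by rewrite segment0 segment1.
- by rewrite /= path_zero path_one segmentxx.
Qed.

Lemma path_homotopic_comp (X Y : topologicalType) (f : X -> Y) (g h : I -> X) :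
  continuous f -> path_homotopic g h -> path_homotopic (f \o g) (f \o h).
Proof.
move=> cf [H [cH Hs Ht]]; exists (f \o H); split.
- exact: continuous_compT cH cf.
- by move=> s /=; have [-> ->] := Hs s.
- by move=> t /=; have [-> ->] := Ht t.
Qed.

(** Passes from sets of classes to representatives, the form in which the condition is checked and
    used. *)
Lemma pi1_map_subP (Y E X : topologicalType) (f : Y -> X) (p : E -> X)
    (y : Y) (e : E) (x : X) :
  continuous f -> continuous p -> f y = x -> p e = x ->
  pi1_map f y x @` pi1 R y `<=` pi1_map p e x @` pi1 R e <->
  forall g : loop R y, exists k : loop R e, path_homotopic (f \o g) (p \o k).
Proof.
move=> cf cp fy pe; split=> [sub g|fgpk _ [_ [g _ <-] <-]].
  have [|_ [k _ <-] kE] := sub (pi1_map f y x [set h : loop R y | path_homotopic g h]).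
    by exists [set h : loop R y | path_homotopic g h] => //; exists g.
  have cfg : continuous (f \o g) := continuous_compT (@cts_fun _ _ g) cf.
  have fg0 : (f \o g) zero = x by rewrite /= path_zero.
  have fg1 : (f \o g) one = x by rewrite /= path_one.
  (* The class of [f \o g] is the image of a class of loops in [E]; membership of [l] in that image
     produces [k']. *)
  pose l : loop R x := mk_path cfg fg0 fg1.
  have : pi1_map f y x [set h : loop R y | path_homotopic g h] l.
    exists g; first exact: path_homotopic_refl (@cts_fun _ _ g).
    exact: path_homotopic_refl cfg.
  rewrite -kE => -[k' _ k'l]; exists k'; exact: path_homotopic_sym.
have [k fgk] := fgpk g; exists [set h : loop R e | path_homotopic k h].
  by exists k.
apply/seteqP; split=> h [l /= gl lh].
- exists g; first exact: path_homotopic_refl (@cts_fun _ _ g).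
  apply: (path_homotopic_trans fgk); apply: path_homotopic_trans lh.
  exact: path_homotopic_comp.
- exists k; first exact: path_homotopic_refl (@cts_fun _ _ k).
  apply: (path_homotopic_trans (path_homotopic_sym fgk)).
  by apply: path_homotopic_trans lh; exact: path_homotopic_comp.
Qed.

End homotopy.

(** * Maps into and out of [Delta R E] *)

Section Delta_spaces.
Variable R : realType.
Local Notation I := (itv01 R).

(* Pulling a Delta-open set back along a retract of the disk is the same as
   pulling it back along the disk and then along the section. *)
Lemma Delta_continuous_retract (Z E : topologicalType) (f : Z -> E) :
  disk_retract R Z -> continuous f -> continuous (f : Z -> Delta R E).
Proof.
move=> [s [r [cs cr srK]]] cf; apply/continuousP => U /open_DeltaE oU.
have -> : (f : Z -> Delta R E) @^-1` U = s @^-1` ((f \o r) @^-1` U).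
  by apply/seteqP; split=> z /=; rewrite srK.
by move/continuousP: cs; apply; apply: oU; exact: continuous_compT cr cf.
Qed.

Lemma Delta_id_continuous (E : topologicalType) :
  continuous (id : Delta R E -> E).
Proof.
apply/continuousP => U oU; apply/open_DeltaE => u cu.
by move/continuousP: cu; apply.
Qed.

Lemma Delta_codomain_continuous (Z E : topologicalType) (f : Z -> Delta R E) :
  continuous f -> continuous (f : Z -> E).
Proof. by move=> cf; exact: continuous_compT cf (@Delta_id_continuous E). Qed.

Lemma Delta_DeltaTop0 (E : topologicalType) :
  nonempty_path_connected R E -> DeltaTop0 R (Delta R E).
Proof.
move=> [[e _] pcE]; split; first split; first by exists e.
- move=> x y; have [g] := pcE x y; constructor.
  have cg := Delta_continuous_retract (@disk_retract_itv01 R) (@cts_fun _ _ g).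
  exact: (mk_path cg (path_zero (s := g)) (path_one (s := g))).
- move=> U; split=> [oU u cu|oU]; first by move/continuousP: cu; apply.
  (* Disks in [E] are also disks in [Delta R E], so a second application of Delta adds no open
     sets. *)
  apply/open_DeltaE => u cu; apply: oU.
  exact: Delta_continuous_retract (@disk_retract_disk R) cu.
Qed.

End Delta_spaces.

(** * Unique lifting over retracts of the disk, and well-defined endpoints *)

Section lifting.
Variables (R : realType) (A : topologicalType -> Prop) (E X : topologicalType).
Variable p : E -> X.
Hypotheses (A_disk : A (disk R)) (p_cov : is_covering R A p).
Local Notation I := (itv01 R).

Let p_cont : continuous p. Proof. by case: p_cov. Qed.

(** The map [f \o r] on the disk lifts because loops there are null-homotopic; restrict its lift
    along [s]. *)
Lemma lift_retract (Z : topologicalType) (z : Z) (e : E) (f : Z -> X) :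
  disk_retract R Z -> continuous f -> f z = p e ->
  exists g : Z -> E, [/\ continuous g, g z = e & p \o g = f].
Proof.
move=> [s [r [cs cr srK]]] cf fz.
have cfr : continuous (f \o r) := continuous_compT cr cf.
have frz : (f \o r) (s z) = p e by rewrite /= srK.
have [_ _ lift] := p_cov.
have [|g [[cg ge pg] _]] := lift _ e (s z) (f \o r) A_disk cfr frz.
  apply/pi1_map_subP => // g; exists (cst e).
  apply: path_homotopic_trans.
    exact: path_homotopic_comp cfr (disk_loop_null g).
  have -> : (f \o r) \o cst (s z) = p \o cst e :> (I -> X).
    by apply/funext => t /=; rewrite srK.
  exact: path_homotopic_refl (@cst_continuous I X (p e)).
exists (g \o s); split=> //; first exact: continuous_compT cs cg.
by rewrite compA pg; apply/funext => x /=; rewrite srK.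
Qed.

(** Both [g \o r] and [h \o r] lift [p \o (g \o r)] from the same base point, and [s] recovers [g]
    and [h] from them. *)
Lemma lift_retract_uniq (Z : topologicalType) (z : Z) (g h : Z -> E) :
  disk_retract R Z -> continuous g -> continuous h -> g z = h z ->
  p \o g = p \o h -> g = h.
Proof.
move=> [s [r [cs cr srK]]] cg ch ghz pgh.
have cgr : continuous (p \o (g \o r)).
  exact: continuous_compT (continuous_compT cr cg) p_cont.
have [_ _ lift] := p_cov.
have := lift _ (g z) (s z) (p \o (g \o r)) A_disk cgr.
rewrite /= srK => /(_ erefl)[|k [_ kP]].
  apply/pi1_map_subP => //=; first by rewrite srK.
  move=> l; exists (cst (g z)); apply: path_homotopic_trans.
    exact: path_homotopic_comp cgr (disk_loop_null l).
  have -> : (p \o (g \o r)) \o cst (s z) = p \o cst (g z) :> (I -> X).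
    by apply/funext => t /=; rewrite srK.
  exact: path_homotopic_refl (@cst_continuous I X (p (g z))).
have kg : k = g \o r by apply: kP; split; rewrite /= ?srK //; exact: continuous_compT.
have kh : k = h \o r.
  apply: kP; split; rewrite /= ?srK //; first exact: continuous_compT.
  by rewrite compA -pgh.
apply/funext => x; rewrite -(srK x).
by rewrite -[LHS]/((g \o r) (s x)) -[RHS]/((h \o r) (s x)) -kg -kh.
Qed.

(* The loop at [y] going along [g] and back along [h] is mapped by [f] to a loop
   homotopic to the image of a loop of [E], so lifting the homotopy lifts it to a
   loop; its two halves are the lifts [g'] and the reverse of [h']. *)
Lemma lift_endpoint_uniq (Y : topologicalType) (f : Y -> X) (y : Y) (e : E)
    (g h : I -> Y) (g' h' : I -> E) :
  continuous f -> f y = p e ->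
  pi1_map f y (p e) @` pi1 R y `<=` pi1_map p e (p e) @` pi1 R e ->
  continuous g -> continuous h -> continuous g' -> continuous h' ->
  g zero = y -> h zero = y -> g one = h one ->
  g' zero = e -> h' zero = e -> p \o g' = f \o g -> p \o h' = f \o h ->
  g' one = h' one.
Proof.
move=> cf fy sub cg ch cg' ch' g0 h0 gh1 g'0 h'0 pg' ph'.
have crev : continuous (@itv_rev R) := @aff_continuous R _ _.
have ghr : g one = (h \o @itv_rev R) zero by rewrite /= itv_rev0.
have cl : continuous (chain g (h \o @itv_rev R)).
  exact: chain_continuous cg (continuous_compT crev ch) ghr.
have l0 : chain g (h \o @itv_rev R) zero = y by rewrite chain0.
have l1 : chain g (h \o @itv_rev R) one = y by rewrite chain1 //= itv_rev1.
have /pi1_map_subP := sub; move=> /(_ cf p_cont fy erefl).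
move=> /(_ (mk_path cl l0 l1))[k [H [cH Hs Ht]]].
have fl0 : (f \o mk_path cl l0 l1) zero = p e by rewrite -fy; congr f.
have fl1 : (f \o mk_path cl l0 l1) one = p e by rewrite -fy; congr f.
have H00 : H (zero, zero) = p e by rewrite (Hs zero).1.
have [K [cK K00 pK]] := lift_retract (@disk_retract_square R) cH H00.
have pKE s t : p (K (s, t)) = H (s, t) by rewrite -pK.
have cid : continuous (@id I) by move=> t; exact: cvg_id.
have cK1 (b : I) : continuous (fun t => K (b, t)).
  apply: (continuous_compT _ cK); apply: continuous_pair => //.
  exact: cst_continuous.
have cK2 (b : I) : continuous (fun t => K (t, b)).
  apply: (continuous_compT _ cK); apply: continuous_pair => //.
  exact: cst_continuous.
have retI := @disk_retract_itv01 R.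
(* Three sides of [K] are found in turn by unique path lifting: [K (zero, _)] is constant, so
   [K (_, one)] starts at [e] and is [k], so [K (one, _)] ends at [e] and is constant. *)
have K0 : (fun t => K (zero, t)) = cst e.
  apply: (lift_retract_uniq (z := zero)) => //; first exact: cst_continuous.
  by apply/funext => t /=; rewrite pKE (Ht t).1.
have Kk : (fun s => K (s, one)) = k.
  apply: (lift_retract_uniq (z := zero)) => //; first exact: cts_fun.
    by rewrite path_zero; exact: (congr1 (@^~ one) K0).
  by apply/funext => t /=; rewrite pKE (Hs t).2.
have K1 : (fun t => K (one, t)) = cst e.
  apply: (lift_retract_uniq (z := one)) => //; first exact: cst_continuous.
    by rewrite -[RHS](path_one (s := k)); exact: (congr1 (@^~ one) Kk).
  by apply/funext => t /=; rewrite pKE (Ht t).2.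
have Kl t : p (K (t, zero)) = f (chain g (h \o @itv_rev R) t).
  by rewrite pKE (Hs t).1.
have -> : g' = (fun t => K (t, zero)) \o @half1 R.
  apply: (lift_retract_uniq (z := zero)) => //=.
  - exact: continuous_compT (@aff_continuous R _ _) (cK2 _).
  - by rewrite half1_0 K00.
  - rewrite pg'; apply/funext => t /=; rewrite Kl.
    by rewrite -[in LHS](chain_half1 g (h \o @itv_rev R)).
(* Read backwards from [K (one, zero) = e], the second half of the side [K (_, zero)] lifts
   [f \o h]. *)
have -> : h' = (fun t => K (t, zero)) \o @half2 R \o @itv_rev R.
  apply: (lift_retract_uniq (z := zero)) => //=.
  - apply: continuous_compT crev _.
    exact: continuous_compT (@aff_continuous R _ _) (cK2 _).
  - by rewrite itv_rev0 half2_1 h'0; exact/esym/(congr1 (@^~ zero) K1).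
  - rewrite ph'; apply/funext => t /=; rewrite Kl.
    rewrite -[chain _ _ _]/((chain g (h \o @itv_rev R) \o @half2 R) (itv_rev t)).
    by rewrite chain_half2 //= itv_revK.
by rewrite /= itv_rev1 half_mid.
Qed.

End lifting.

(** * Lifting maps from Delta-generated spaces to [Delta R E] *)

Section Delta_lifting.
Variables (R : realType) (A : topologicalType -> Prop) (E X : topologicalType).
Variable p : E -> X.
Hypotheses (A_disk : A (disk R)) (p_cov : is_covering R A p).
Local Notation I := (itv01 R).

Let p_cont : continuous p. Proof. by case: p_cov. Qed.

Section lift_along_paths.
Variables (Y : topologicalType) (f : Y -> X) (y : Y) (e : E).
Hypotheses (f_cont : continuous f) (fy : f y = p e).
Hypothesis sub_pi1 :
  pi1_map f y (p e) @` pi1 R y `<=` pi1_map p e (p e) @` pi1 R e.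

(** The graph of the future lift, kept as a relation so that paths need not be chosen before
    independence of the path is known. *)
Definition lifts_to (y' : Y) (e' : E) : Prop :=
  exists (g : I -> Y) (g' : I -> E),
    [/\ continuous g, continuous g', g zero = y /\ g' zero = e,
        g one = y' /\ g' one = e' & p \o g' = f \o g].

Lemma lifts_to_base : lifts_to y e.
Proof.
exists (cst y), (cst e); split=> //; try exact: cst_continuous.
by apply/funext => t /=.
Qed.

Lemma lifts_to_uniq (y' : Y) (e1 e2 : E) :
  lifts_to y' e1 -> lifts_to y' e2 -> e1 = e2.
Proof.
move=> [g [g' [cg cg' [g0 g'0] [g1 <-] pg]]] [h [h' [ch ch' [h0 h'0] [h1 <-] ph]]].
apply: (lift_endpoint_uniq A_disk p_cov f_cont fy sub_pi1 cg ch) => //.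
by rewrite g1 h1.
Qed.

(** Appending [s] and [s'] to the witnessing paths propagates the relation; this is applied to
    segments of a disk. *)
Lemma lifts_to_step (s : I -> Y) (s' : I -> E) :
  continuous s -> continuous s' -> p \o s' = f \o s ->
  lifts_to (s zero) (s' zero) -> lifts_to (s one) (s' one).
Proof.
move=> cs cs' ps [g [g' [cg cg' [g0 g'0] [g1 g'1] pg]]].
exists (chain g s), (chain g' s'); split.
- exact: chain_continuous.
- exact: chain_continuous.
- by rewrite !chain0.
- by rewrite !chain1.
- by rewrite !comp_chain pg ps.
Qed.

Lemma lifts_to_proj (y' : Y) (e' : E) : lifts_to y' e' -> p e' = f y'.
Proof.
by move=> [g [g' [_ _ _ [<- <-] pg]]]; exact: (congr1 (@^~ one) pg).
Qed.

Lemma lifts_to_total (y' : Y) : path_connected R Y -> exists e', lifts_to y' e'.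
Proof.
move=> pcY; have [g] := pcY y y'.
have cg : continuous g := @cts_fun _ _ g.
have fg0 : (f \o g) zero = p e by rewrite /= path_zero.
have [g' [cg' g'0 pg]] := lift_retract A_disk p_cov (@disk_retract_itv01 R)
  (continuous_compT cg f_cont) fg0.
by exists (g' one), g, g'; split=> //; rewrite ?path_zero ?path_one.
Qed.

Lemma Delta_lift : DeltaTop0 R Y ->
  exists! g : Y -> Delta R E, [/\ continuous g, g y = e & p \o g = f].
Proof.
move=> [[_ pcY] genY].
have [G GP] := choice (fun y' => lifts_to_total y' pcY).
have pG : p \o G = f by apply/funext => y' /=; exact/lifts_to_proj.
exists G; split; first split=> //.
(* Since [Y] is Delta-generated, continuity is tested on disks [u], where [G \o u] is compared with
   a continuous lift [w] of [f \o u]. *)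
- apply/continuousP => U /open_DeltaE oU; apply/genY => u cu.
  rewrite -[X in open X]/((G \o u) @^-1` U).
  suff cGu : continuous (G \o u) by exact: oU.
  pose z0 : disk R := square_disk (zero, zero).
  have fu0 : (f \o u) z0 = p (G (u z0)) by rewrite /= -pG.
  have [w [cw w0 pw]] := lift_retract A_disk p_cov (@disk_retract_disk R)
    (continuous_compT cu f_cont) fu0.
  suff -> : G \o u = w by [].
  (* Along the segment from [z0] to [z] the relation passes from the point [G (u z0)] over [u z0] to
     [w z] over [u z], so [w z] is [G (u z)]. *)
  apply/funext => z; pose s := segment z0 z.
  have cs : continuous s.
    apply: segment_continuous; try exact: cst_continuous.
    by move=> t; exact: cvg_id.
  have := @lifts_to_step (u \o s) (w \o s) (continuous_compT cs cu)
    (continuous_compT cs cw).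
  rewrite compA pw /= /s segment0 segment1 w0 => /(_ erefl (GP _)).
  exact: lifts_to_uniq.
- exact: lifts_to_uniq (GP y) lifts_to_base.
(* Any other lift [h] carries a path [g] to a lift of [f \o g], so [h y'] also satisfies
   [lifts_to y']. *)
- move=> h [/Delta_codomain_continuous ch hy ph]; apply/funext => y'.
  have [g] := pcY y y'; have cg : continuous g := @cts_fun _ _ g.
  apply: lifts_to_uniq (GP y') _.
  exists g, (h \o g); split=> //=; rewrite ?path_zero ?path_one //.
    exact: continuous_compT cg ch.
  by rewrite compA ph.
Qed.

End lift_along_paths.

(** Loops in [Delta R E] are loops in [E], so the pi_1 condition for the former gives the one for
    [p] on [E]. *)
Lemma is_covering_Delta : nonempty_path_connected R E ->
  is_covering R (DeltaTop0 R) (p : Delta R E -> X).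
Proof.
move=> E_pc; have cpD : continuous (p : Delta R E -> X).
  exact: continuous_compT (@Delta_id_continuous R E) p_cont.
split=> //; first exact: Delta_DeltaTop0.
move=> Y e y f DY cf fy /(pi1_map_subP R cf cpD fy erefl) sub.
apply: (@Delta_lift _ f y e) => //.
apply/pi1_map_subP => // g; have [k gk] := sub g.
have ck := Delta_codomain_continuous (@cts_fun _ _ k).
by exists (mk_path ck (path_zero (s := k)) (path_one (s := k))).
Qed.

End Delta_lifting.

(** * Full faithfulness *)

Lemma Delta_lift_continuous (R : realType) (A : topologicalType -> Prop)
    (E E' X : topologicalType) (p : E -> X) (q : E' -> X)
    (h : Delta R E -> Delta R E') :
  A (disk R) -> A E -> nonempty_path_connected R E -> continuous p ->
  is_covering R A q -> continuous h -> q \o h = p ->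
  continuous (h : E -> E').
Proof.
move=> A_disk AE [[e _] pcE] cp q_cov ch qhD.
have qh : q \o (h : E -> E') = p := qhD.
have hcomp (g : itv01 R -> E) : continuous g -> continuous (h \o g : _ -> E').
  move=> cg; apply: (@Delta_codomain_continuous R).
  apply: continuous_compT ch.
  exact: Delta_continuous_retract (@disk_retract_itv01 R) cg.
have [cq _ lift] := q_cov.
have pe : p e = q (h e) by rewrite -qh.
(* As [E] lies in [A], the map [p] itself can be lifted through [q]. *)
have [|k [[ck ke qk] _]] := lift E (h e) e p AE cp pe.
  apply/pi1_map_subP => // g.
  have hg0 : h (g zero) = h e by rewrite path_zero.
  have hg1 : h (g one) = h e by rewrite path_one.
  (* The loop [h \o g] has image exactly [p \o g] under [q], so a constant homotopy suffices. *)
  exists (mk_path (hcomp _ (@cts_fun _ _ g)) hg0 hg1).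
  have -> : p \o g = q \o (h \o g) by rewrite -qh.
  apply: path_homotopic_refl.
  exact: continuous_compT (hcomp _ (@cts_fun _ _ g)) cq.
(* Along a path from [e] to [x], [h] and [k] give two lifts of the same path from [h e]. *)
suff -> : h = k by [].
apply/funext => x; have [g] := pcE e x.
rewrite -(path_one (s := g)); apply: (congr1 (@^~ one) (x := h \o g) (y := k \o g)).
apply: (lift_retract_uniq A_disk q_cov (z := zero) (@disk_retract_itv01 R)).
- exact: hcomp (@cts_fun _ _ g).
- exact: continuous_compT (@cts_fun _ _ g) ck.
- by rewrite /= path_zero ke.
- by rewrite -[LHS]/((q \o h) \o g) qh -qk.
Qed.

Theorem theorem41 (R : realType) (C : topologicalType -> Prop)
    (C_sub : forall Y : topologicalType,
       C Y -> nonempty_path_connected R Y)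
    (C_disk : C (disk R))
    (X : topologicalType) (X_pc : path_connected R X) :
  exists wd : (forall p : covering R C X,
                 is_covering R (DeltaTop0 R) (Delta_map p)),
    fully_faithful (canonical_functor wd).
Proof.
have CE (p : covering R C X) : C (cov_space p) by have [] := cov_mapP p.
have wd (p : covering R C X) : is_covering R (DeltaTop0 R) (Delta_map p).
  exact: is_covering_Delta C_disk (cov_mapP p) (C_sub _ (CE p)).
exists wd; split=> [p q h|p q f g fg].
- have cp : continuous (@cov_map R C X p) by have [] := cov_mapP p.
  have ch := Delta_lift_continuous C_disk (CE p) (C_sub _ (CE p)) cp
    (cov_mapP q) (cov_fun_continuous h) (cov_funE h).
  exists (CovHom ch (cov_funE h) : cov_hom p q).
  (* The two morphisms share the function [h] and differ only in proofs. *)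
  exact (@cov_hom_eq _ _ _ (canonical_ob wd p) (canonical_ob wd q)
           (canonical_hom wd (CovHom ch (cov_funE h))) h erefl).
- apply: (@cov_hom_eq R C X p q).
  exact (congr1 (@cov_fun _ _ _ (canonical_ob wd p) (canonical_ob wd q)) fg).
Qed.
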